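(* Let $n\ge 1$. For a vector $\mathbf d=(d_1,\dots,d_n)\in\mathbb Z^n$ the following are equivalent: (i) there is a bigraph $B$ on the node set $[n]$ with net-degree sequence $\mathbf d(B)=\mathbf d$; (ii) $\widehat{\mathbf d}\in \mathcal B_n\cap\mathbb Z^{n+1}$; (iii) $d_1+\cdots+d_n$ is even and $-(n-1)\le d_i\le n-1$ for all $i=1,\dots,n$.
   Context: $[n]=\{1,\dots,n\}$. A bidirected graph (bigraph) is a pair $B=(G,\tau)$ where $G=(V,E)$ is a finite simple undirected graph (no loops, no parallel edges) and $\tau:V\times E\to\{-1,0,1\}$ satisfies $\tau(v,e)\in\{-1,1\}$ if $v$ is incident to $e$ and $\tau(v,e)=0$ otherwise. The net-degree of a node $v$ is $\mathbf d(B)_v=\sum_{e\in E}\tau(v,e)$, and the net-degree sequence is $\mathbf d(B)=(\mathbf d(B)_v)_{v\in V}$. For $\mathbf x\in\mathbb R^n$ write $\widehat{\mathbf x}=(\mathbf x,\tfrac12(x_1+\cdots+x_n))\in\mathbb R^{n+1}$; $e_1,\dots,e_n$ is the standard basis of $\mathbb R^n$. The polytope $\mathcal B_n\subset\mathbb R^{n+1}$ is the convex hull of all points $\sum_{1\le i<j\le n}\bigl(\tau_{ij}\,\widehat{e}_i+\tau_{ji}\,\widehat{e}_j\bigr)$ where $\tau=(\tau_{ij})$ ranges over $\{-1,+1\}^{n\times n}$. *)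

(* Defs.v *)
From mathcomp Require Import all_boot all_order all_algebra.
From mathcomp Require Import boolp classical_sets reals convex.

Set Implicit Arguments.
Unset Strict Implicit.
Unset Printing Implicit Defensive.

Import Order.TTheory GRing.Theory Num.Theory.

Local Open Scope classical_set_scope.
Local Open Scope ring_scope.

(* An edge is a set of exactly two nodes, which rules out loops and parallel
   edges. *)
Record simple_graph (V : finType) := SimpleGraph {
  edges : {set {set V}};
  card_edge : forall e, e \in edges -> #|e| = 2%N
}.

Notation edge G := {e | e \in edges G}.

Record bigraph (V : finType) := Bigraph {
  bigraph_graph : simple_graph V;
  tau : V -> edge bigraph_graph -> int;
  tau_incident : forall (v : V) (e : edge bigraph_graph), v \in val e -> tau v e = -1 \/ tau v e = 1;
  tau_not_incident : forall (v : V) (e : edge bigraph_graph), v \notin val e -> tau v e = 0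
}.

Definition net_degree (V : finType) (B : bigraph V) (v : V) : int :=
  \sum_(e : edge (bigraph_graph B)) tau v e.

Definition net_degree_seq (n : nat) (B : bigraph 'I_n) : 'rV[int]_n :=
  \row_v net_degree B v.

(* The library provides convex sets, but not convex hulls. *)
Definition convex_hull (R : numDomainType) (M : lmodType R) (A : set M) : set M :=
  smallest (@convex_set R M) A.

Definition hat (R : realType) (n : nat) (x : 'rV[R]_n) : 'rV[R]_(n + 1) :=
  row_mx x (2^-1 * \sum_i x 0 i)%:M.

(* The diagonal entries of t are unused. *)
Definition bigraph_point (R : realType) (n : nat) (t : 'M[R]_n) : 'rV[R]_(n + 1) :=
  \sum_(i < n) \sum_(j < n | (i < j)%N)
    (t i j *: hat (delta_mx 0 i) + t j i *: hat (delta_mx 0 j)).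

Definition bigraph_polytope (R : realType) (n : nat) : set 'rV[R]_(n + 1) :=
  convex_hull [set bigraph_point t | t in
    [set t : 'M[R]_n | forall i j, t i j = -1 \/ t i j = 1]].

Arguments bigraph_polytope : clear implicits.

Definition int_points (R : realType) (n : nat) : set 'rV[R]_n :=
  range (fun z : 'rV[int]_n => map_mx intr z).

Arguments int_points : clear implicits.

(* Main.v *)
(** The two signs on an edge are independent, so on a graph with degrees [deg v]
    every sequence with [`|d v| <= deg v] and [d v = deg v] mod 2 is a
    net-degree sequence.  Under (iii), the set of nodes at which [d v] has the
    wrong parity for the complete graph has even size; deleting a perfect
    matching of this set from the complete graph repairs the parities, and the
    bounds survive because [d v] already differed in parity from [n - 1].
    On the polyhedral side, the generating points are multi-affine in the signs,
    so moving one coordinate at a time between -1 and 1 fills the whole image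
    under [hat] of the cube of half-width [n - 1]; integrality of the last
    coordinate of [hat d] is the parity condition. *)

From HB Require Import structures.
Require Import Defs.
From mathcomp Require Import all_boot all_order all_algebra.
From mathcomp Require Import zify ring lra.
From mathcomp Require Import interval_inference boolp classical_sets reals convex.
Import Order.TTheory GRing.Theory Num.Theory.

Local Open Scope ring_scope.

(** * Bounds and parity of net-degrees *)

Definition degree {V : finType} (G : simple_graph V) (v : V) : nat :=
  #|[set e in edges G | v \in e]|.

Lemma card_incident_edges {V : finType} (G : simple_graph V) (v : V) :
  #|[set e : edge G | v \in val e]| = degree G v.
Proof.
rewrite -(card_imset _ val_inj); apply: eq_card => e; rewrite !inE.
apply/imsetP/andP => [[e']|[eG ve]].
  by rewrite inE => ve ->; split => //; exact: valP.
by exists (Sub e eG); rewrite ?inE.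
Qed.

Lemma degree_le {V : finType} (G : simple_graph V) (v : V) :
  (degree G v <= #|V|.-1)%N.
Proof.
have sub : [set e in edges G | v \in e] \subset
    [set [set v; u] | u in [set~ v]].
  apply/fintype.subsetP => e; rewrite inE => /andP[eG ve].
  have /cards2P[x [y [xy exy]]] : #|e| == 2%N by rewrite (card_edge eG).
  move: ve; rewrite exy !inE => /orP[/eqP ->|/eqP ->]; apply/imsetP.
  - by exists y; rewrite // !inE eq_sym.
  - by exists x; rewrite 1?finset.setUC // !inE.
apply: leq_trans (subset_leq_card sub) _.
by apply: leq_trans (leq_imset_card _ _) _; rewrite cardsC1.
Qed.

Lemma net_degree_le {V : finType} (B : bigraph V) (v : V) :
  `|net_degree B v| <= (degree (bigraph_graph B) v)%:R.
Proof.
apply: le_trans (ler_norm_sum _ _ _) _.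
rewrite -card_incident_edges -sumr_const big_mkcond [leRHS]big_mkcond /=.
apply: ler_sum => e _; rewrite !inE; case: ifP => ve.
- by have [->|->] := tau_incident ve; rewrite ?normrN normr1.
- by rewrite tau_not_incident ?normr0 // ve.
Qed.

(** Summed edge by edge, each edge contributes the two signs at its ends, hence -2, 0 or 2. *)
Lemma sum_net_degree_even {V : finType} (B : bigraph V) :
  (2 %| \sum_v net_degree B v)%Z.
Proof.
rewrite /net_degree exchange_big /=; apply: rpred_sum => e _.
rewrite (bigID (mem (val e))) /= [X in _ + X]big1 ?addr0; last first.
  by move=> v; exact: tau_not_incident.
have /cards2P[x [y [xy exy]]] : #|val e| == 2%N by rewrite (card_edge (valP e)).
rewrite (eq_bigl (mem [set x; y])); last by move=> v; rewrite exy.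
rewrite big_setU1 ?inE // big_set1.
have [xe ye] : x \in val e /\ y \in val e by rewrite exy !inE !eqxx orbT.
by have [->|->] := tau_incident xe; have [->|->] := tau_incident ye.
Qed.

(** * Realizing a sequence by a bigraph *)

Lemma bigraph_of_graph {V : finType} (G : simple_graph V) (d : V -> int) :
  (forall v, `|d v| <= (degree G v)%:Z) ->
  (forall v, (2 %| d v + (degree G v)%:Z)%Z) ->
  exists B : bigraph V, forall v, net_degree B v = d v.
Proof.
move=> d_le d_par.
(* [P v] is the set of edges that get sign +1 at [v]. It must have [(d v + degree G v) / 2]
   elements, a number between 0 and the degree by the two hypotheses. *)
have /fin_all_exists[P P_spec] (v : V) : exists P : {set edge G},
    P \subset [set e : edge G | v \in val e] /\
    (#|P|%:Z *+ 2 = d v + (degree G v)%:Z).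
  have := d_par v; have := d_le v; rewrite -card_incident_edges => dle /dvdzP[q dq].
  have /card_geqP[s [us sz sub]] : (`|q| <= #|[set e : edge G | v \in val e]|)%N.
    by move: dle dq; set m := #|_|; lia.
  exists [set e in s]; split.
    by apply/fintype.subsetP => e; rewrite inE; exact: sub.
  by rewrite cardsE (card_uniqP us) sz; move: dle dq; set m := #|_|; lia.
pose t (v : V) (e : edge G) : int :=
  if v \in val e then (if e \in P v then 1 else -1) else 0.
have ht1 (v : V) (e : edge G) : v \in val e -> t v e = -1 \/ t v e = 1.
  by rewrite /t => ->; case: ifP; [right|left].
have ht0 (v : V) (e : edge G) : v \notin val e -> t v e = 0.
  by rewrite /t => /negPf ->.
exists (Bigraph ht1 ht0) => v; rewrite /net_degree /=.
have [/fintype.subsetP Psub Pcard] := P_spec v.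
(* As [P v] consists of edges at [v], the sign is twice the indicator of [P v] minus the indicator
   of incidence. *)
transitivity (\sum_(e : edge G)
    (((e \in P v)%:R : int) *+ 2 - ((v \in val e)%:R : int))).
  apply: eq_bigr => e _; rewrite /t.
  by have := Psub e; rewrite inE; case: (e \in P v) => [->|_] //; case: (v \in val e).
rewrite sumrB sumrMnl -!natr_sum -!big_mkcond /= !sum1_card.
rewrite -card_incident_edges cardsE in Pcard.
have -> : #|P v|%:R *+ 2 = #|P v|%:Z *+ 2 by rewrite natz.
by rewrite Pcard natz addrK.
Qed.

(** A perfect matching of [A], encoded as the involution that swaps partners and fixes every node
    outside [A]; it is built by pairing off two elements at a time. *)
Lemma involution_support {T : finType} (A : {set T}) : ~~ odd #|A| ->
  exists2 f : T -> T, involutive f & forall x, (f x != x) = (x \in A).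
Proof.
have [m] := ubnP #|A|; elim: m A => // m IH A Am A_even.
have [A0|[x xA]] := set_0Vmem A.
  by exists id => // x; rewrite A0 inE eqxx.
have [A0|[y]] := set_0Vmem (A :\ x).
  by move: A_even; rewrite (cardsD1 x) xA A0 cards0.
rewrite !inE => /andP[yx yA].
have cA : #|A| = #|A :\ x :\ y|.+2.
  by rewrite (cardsD1 x A) xA (cardsD1 y (A :\ x)) !inE yx yA.
have [||f fK fA] := IH (A :\ x :\ y).
- by move: Am; rewrite cA; lia.
- by move: A_even; rewrite cA /= negbK.
have fx : f x = x by apply/eqP; rewrite -[_ == _]negbK fA !inE eqxx andbF.
have fy : f y = y by apply/eqP; rewrite -[_ == _]negbK fA !inE eqxx.
exists (fun z => if z == x then y else if z == y then x else f z) => z.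
- have [->|zx] := eqVneq z x; first by rewrite (negPf yx) eqxx.
  have [->|zy] := eqVneq z y; first by rewrite eqxx.
  by rewrite -{1}fx (can_eq fK) (negPf zx) -{1}fy (can_eq fK) (negPf zy) fK.
- have [->|zx] := eqVneq z x; first by rewrite yx xA.
  have [->|zy] := eqVneq z y; first by rewrite eq_sym yx yA.
  by rewrite fA !inE zx zy.
Qed.

(** Take the complete graph without the edges joining [v] to [f v]: exactly the nodes moved by [f]
    lose one neighbour. *)
Lemma matching_complement {V : finType} (f : V -> V) : involutive f ->
  exists G : simple_graph V, forall v, (degree G v + (f v != v) = #|V|.-1)%N.
Proof.
move=> fK.
pose adj (u v : V) := (u != v) && (f u != v).
pose E := [set [set p.1; p.2] | p in [set p : V * V | adj p.1 p.2]].
have E2 (e : {set V}) : e \in E -> #|e| = 2%N.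
  by case/imsetP => p; rewrite inE => /andP[p12 _] ->; rewrite cards2 p12.
exists (SimpleGraph E2) => v; rewrite /degree /=.
have -> : [set e in E | v \in e] = [set [set v; u] | u in adj v].
  apply/setP => e; rewrite inE; apply/andP/imsetP => [[/imsetP[[x y]]]|[u vu ->]].
    rewrite inE /= => xy -> /set2P[] ->; first by exists y.
    exists x; last by rewrite finset.setUC.
    (* [adj] is symmetric because [f] is an involution. *)
    by move: xy; rewrite !unfold_in /adj eq_sym (inv_eq fK) [_ == f _]eq_sym.
  by split; [apply/imsetP; exists (v, u); rewrite ?inE|rewrite !inE eqxx].
rewrite card_in_imset => [|x y xv yv /setP/(_ x)]; last first.
  rewrite !inE eqxx orbT => /esym/orP[/eqP xv'|/eqP //].
  by move: xv; rewrite xv' unfold_in /adj eqxx.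
(* If [f v = v], then removing [f v] changes nothing, which accounts for the term [f v != v]. *)
have -> : #|adj v| = #|[set~ v] :\ f v|.
  by apply: eq_card => u; rewrite !inE unfold_in /adj andbC ![u == _]eq_sym.
have := cardsD1 (f v) [set~ v].
by rewrite cardsC1 !inE addnC => ->.
Qed.

Lemma bigraph_of_degrees {V : finType} (d : V -> int) :
  (2 %| \sum_v d v)%Z -> (forall v, `|d v| <= #|V|.-1%:Z) ->
  exists B : bigraph V, forall v, net_degree B v = d v.
Proof.
move=> d_even d_le.
pose A := [set v | ~~ (2 %| d v + #|V|.-1%:Z)%Z].
have A_even : ~~ odd #|A|.
  (* Correcting by the indicator of [A] makes every summand even; since [#|V| * #|V|.-1] and the sum
     of [d] are even, so is [#|A|]. *)
  have h : (2 %| \sum_(v : V) (d v + #|V|.-1%:Z - (v \in A)%:R))%Z.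
    apply: rpred_sum => v _; rewrite inE.
    by case: (boolP (2 %| _)%Z) => /= h; move: h; set m := #|V|.-1; lia.
  move: h; rewrite sumrB big_split /= sumr_const -natr_sum -big_mkcond sum1_card natz.
  rewrite -[#|xpredT|]/#|V|.
  have : (2 %| (#|V|.-1%:Z *+ #|V|))%Z.
    case: #|V| => [//|m].
    have -> : m.+1.-1%:Z *+ m.+1 = (m * m.+1)%N%:Z by lia.
    by rewrite dvdzE dvdn2 oddM /= andbN.
  move: d_even; set s := \sum_v d v; set p := _ *+ _; set a := #|A|; lia.
have [f fK fA] := involution_support _ A_even.
have [G degG] := matching_complement _ fK.
(* For [v] in [A] the parities differ, so [d v] is not extremal and its absolute value is at most
   [#|V|.-1 - 1], the degree of [v]. *)
apply: (bigraph_of_graph G) => v; have := degG v; have := d_le v;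
  rewrite fA inE; set m := #|V|.-1; case: (boolP (2 %| _)%Z); lia.
Qed.

(** * The polytope and its integer points *)

Local Open Scope classical_set_scope.
Local Open Scope ring_scope.

Lemma convex_set_hull {R : numDomainType} {M : lmodType R} (A : set M) :
  convex_set (convex_hull A).
Proof.
move=> x y l /set_mem hx /set_mem hy; apply/mem_set => C [Cconv AC].
by apply/set_mem/Cconv; apply/mem_set; [apply: hx|apply: hy].
Qed.

Lemma convex_hull_segment {R : numDomainType} {M : lmodType R} (A : set M)
    (x y : M) (l : R) :
  0 <= l -> l <= 1 -> convex_hull A x -> convex_hull A y ->
  convex_hull A (l *: x + (1 - l) *: y).
Proof.
move=> l0 l1 /mem_set hx /mem_set hy.
exact: set_mem (@convex_set_hull _ _ A x y (Itv01 l0 l1) hx hy).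
Qed.

Lemma hat_is_linear {R : realType} {n : nat} : linear (@hat R n).
Proof.
move=> a x y; rewrite /hat scale_row_mx add_row_mx; congr row_mx.
rewrite scale_scalar_mx -raddfD /=; congr (_%:M).
under eq_bigr do rewrite !mxE.
by rewrite big_split /= -mulr_sumr mulrDr mulrCA.
Qed.

HB.instance Definition _ (R : realType) (n : nat) :=
  GRing.isLinear.Build R 'rV[R]_n 'rV[R]_(n + 1) _ (@hat R n) hat_is_linear.

(** Regrouping by nodes and using linearity of [hat], each generator is the image of the vector of
    off-diagonal row sums of [t]. *)
Lemma bigraph_point_hat {R : realType} {n : nat} (t : 'M[R]_n) :
  bigraph_point t = hat (\row_i \sum_(j < n | j != i) t i j).
Proof.
have split_sum : bigraph_point t =
    \sum_(i < n) \sum_(j < n | (i < j)%N) t i j *: hat (delta_mx 0 i) +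
    \sum_(i < n) \sum_(j < n | (j < i)%N) t i j *: hat (delta_mx 0 i).
  rewrite /bigraph_point [X in _ = _ + X](exchange_big_dep xpredT) //= -big_split.
  by apply: eq_bigr => i _; rewrite big_split.
rewrite split_sum [X in hat X]row_sum_delta linear_sum -big_split /=.
apply: eq_bigr => i _; rewrite mxE linearZ /= -!scaler_suml -scalerDl; congr (_ *: _).
rewrite [RHS](bigID (fun j : 'I_n => (i < j)%N)) /=; congr (_ + _);
  by apply: eq_bigl => j; rewrite -val_eqE /=; case: ltngtP.
Qed.

Lemma card_neq_ord {n : nat} (i : 'I_n) : #|[pred j | j != i]| = n.-1.
Proof.
by rewrite -[in RHS](card_ord n) -(cardsC1 i); apply: eq_card => j; rewrite !inE.
Qed.

Lemma hat_in_polytope {R : realType} {n : nat} (c : 'rV[R]_n) :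
  (forall i, -1 <= c 0 i <= 1) -> bigraph_polytope R n (hat (n.-1%:R *: c)).
Proof.
(* Induction on the number [k] of leading coordinates allowed to lie strictly between -1 and 1; for
   [k = n] all are free. *)
suff ind k (b : 'rV[R]_n) : (forall i, -1 <= b 0 i <= 1) ->
    (forall i : 'I_n, (k <= i)%N -> b 0 i = -1 \/ b 0 i = 1) ->
    bigraph_polytope R n (hat (n.-1%:R *: b)).
  by move=> c1; apply: (ind n) => // i; rewrite leqNgt ltn_ord.
elim: k b => [|k IH] b b1 bk.
  (* Constant rows [b 0 i] have off-diagonal sum [n.-1 * b 0 i]. *)
  apply: sub_gen_smallest; exists (\matrix_(i, j) b 0 i).
    by move=> i j; rewrite mxE; exact: bk.
  rewrite bigraph_point_hat; congr hat; apply/rowP => i; rewrite !mxE.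
  under eq_bigr do rewrite mxE.
  by rewrite sumr_const card_neq_ord mulr_natl.
have [kn|nk] := ltnP k n; last first.
  by apply: IH => // i ki; have := ltn_ord i; rewrite ltnNge (leq_trans nk ki).
pose o := Ordinal kn.
pose b' (s : R) := \row_i (if i == o then s else b 0 i) : 'rV[R]_n.
have b'_in s : s = -1 \/ s = 1 -> bigraph_polytope R n (hat (n.-1%:R *: b' s)).
  move=> s1; apply: IH => i; rewrite mxE; case: eqP => [_|io] //.
  - by case: s1 => ->; lra.
  - move=> ki; apply: bk; rewrite ltn_neqAle ki andbT.
    by apply/eqP => kEi; apply: io; apply: val_inj.
have := b1 o; set l := (1 + b 0 o) / 2 => /andP[b1l b1u].
(* The weight [l] solves [l - (1 - l) = b 0 o]; the other coordinates agree at both ends. *)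
have -> : hat (n.-1%:R *: b) =
    l *: hat (n.-1%:R *: b' 1) + (1 - l) *: hat (n.-1%:R *: b' (-1)).
  rewrite -!linearZ -linearD; congr hat; apply/rowP => i; rewrite !mxE.
  by case: eqP => [->|_]; rewrite /l; field.
apply: convex_hull_segment; [rewrite /l; lra|rewrite /l; lra| |].
- by apply: b'_in; right.
- by apply: b'_in; left.
Qed.

(** The bound defines a convex set containing the generators, where the coordinate is a sum of
    [n.-1] signs. *)
Lemma polytope_coord_le {R : realType} {n : nat} (x : 'rV[R]_(n + 1)) (i : 'I_n) :
  bigraph_polytope R n x -> `|x 0 (lshift 1 i)| <= n.-1%:R.
Proof.
move: x; apply: smallest_sub.
  move=> x y l /set_mem /= hx /set_mem /= hy; apply/mem_set => /=.
  rewrite !mxE; apply: le_trans (ler_normD _ _) _; rewrite !normrM.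
  have l0 : 0 <= l%:num by [].
  have l1 : 0 <= 1 - l%:num by rewrite subr_ge0.
  rewrite (ger0_norm l0) (ger0_norm l1).
  have -> : n.-1%:R = l%:num * n.-1%:R + (1 - l%:num) * n.-1%:R by ring.
  by apply: lerD; apply: ler_wpM2l.
move=> _ [t t1 <-] /=; rewrite bigraph_point_hat /hat row_mxEl mxE.
apply: le_trans (ler_norm_sum _ _ _) _.
rewrite -(card_neq_ord i) -sumr_const; apply: ler_sum => j _.
by case: (t1 i j) => ->; rewrite ?normrN normr1.
Qed.

Lemma hat_int_points {R : realType} {n : nat} (d : 'rV[int]_n) :
  int_points R (n + 1) (hat (map_mx intr d)) <-> (2 %| \sum_i d 0 i)%Z.
Proof.
have sum_intr : \sum_i map_mx intr d 0 i = (\sum_i d 0 i)%:~R :> R.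
  by rewrite rmorph_sum; apply: eq_bigr => i _; rewrite mxE.
split=> [[z _ /rowP/(_ (rshift n 0))]|/dvdzP[q dq]].
  rewrite /hat row_mxEr !mxE eqxx mulr1n sum_intr => /(congr1 ( *%R 2)).
  rewrite mulVKf ?pnatr_eq0 // => h.
  apply/dvdzP; exists (z 0 (rshift n 0)).
  by apply: (@intr_inj R); rewrite -h mulrC intrM.
exists (row_mx d q%:M) => //.
rewrite map_row_mx /hat sum_intr dq; congr row_mx.
by rewrite map_scalar_mx /= mulrC intrM mulfK.
Qed.

Theorem theorem4p1 (R : realType) (n : nat) (n_ge1 : (1 <= n)%N) (d : 'rV[int]_n) :
  ((exists B : bigraph 'I_n, net_degree_seq B = d) <->
   (bigraph_polytope R n `&` int_points R (n + 1)) (hat (map_mx intr d))) /\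
  ((bigraph_polytope R n `&` int_points R (n + 1)) (hat (map_mx intr d)) <->
   (2 %| \sum_i d 0 i)%Z /\
   (forall i, - (n%:Z - 1) <= d 0 i /\ d 0 i <= n%:Z - 1)).
Proof.
have nE : n%:Z - 1 = n.-1%:Z by rewrite -subn1 subzn.
have boundE : (forall i, - (n%:Z - 1) <= d 0 i /\ d 0 i <= n%:Z - 1) <->
    (forall i, `|d 0 i| <= n.-1%:Z).
  by rewrite nE; split=> h i; have := h i; rewrite ler_norml;
    [case=> -> ->|move/andP].
have polyE : (bigraph_polytope R n `&` int_points R (n + 1)) (hat (map_mx intr d)) <->
    (2 %| \sum_i d 0 i)%Z /\ (forall i, `|d 0 i| <= n.-1%:Z).
  split=> [[dP /hat_int_points d_even]|[d_even d_le]]; split=> //; last first.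
  - exact/hat_int_points.
  (* For [n = 1] the inverse is 0 by convention; then the bound forces [d = 0], and the rescaling
     identity still holds. *)
  - pose c : 'rV[R]_n := n.-1%:R^-1 *: map_mx intr d.
    have dc i : `|(d 0 i)%:~R| <= n.-1%:R :> R.
      by rewrite -intr_norm [leRHS]pmulrn ler_int.
    have -> : map_mx intr d = n.-1%:R *: c.
      apply/rowP => i; rewrite !mxE; have := dc i.
      have [->|n0] := eqVneq (n.-1%:R : R) 0.
        by rewrite normr_le0 mul0r => /eqP.
      by rewrite mulVKf.
    apply: hat_in_polytope => i; rewrite -ler_norml !mxE normrM normfV normr_nat.
    have := dc i; have [->|n0] := eqVneq (n.-1%:R : R) 0.
      by rewrite invr0 mul0r.
    by rewrite mulrC ler_pdivrMr ?mul1r // lt0r n0 ler0n.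
  - move=> i; have := polytope_coord_le _ i dP.
    by rewrite /hat row_mxEl mxE -intr_norm [leRHS]pmulrn ler_int.
rewrite polyE boundE; split; last by [].
split=> [[B <-]|[d_even d_le]].
  split=> [|i].
    rewrite (eq_bigr (net_degree B)) => [|i _]; last by rewrite mxE.
    exact: sum_net_degree_even.
  rewrite mxE; apply: le_trans (net_degree_le B i) _.
  by rewrite natz lez_nat -[n in n.-1]card_ord; exact: degree_le.
have [|B dB] := bigraph_of_degrees (d 0) d_even; first by rewrite card_ord.
by exists B; apply/rowP => i; rewrite mxE.
Qed.
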